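(* Let $\varphi$ be a quasi-concave function and let $\Lambda_\varphi^{1,\infty}$ be the r.i. quasi-Banach space of all measurable $f$ on $(0,\infty)$ with $\|f\|_{\Lambda_\varphi^{1,\infty}}=\sup_{t>0}f^*(t)\varphi(t)<\infty$. Then $R(\Lambda_\varphi^{1,\infty})=\Lambda_\varphi$.
   Context: All function spaces consist of measurable functions on $(0,\infty)$ with Lebesgue measure; ''r.i.'' means rearrangement invariant. Equality of spaces means equality as sets with equivalent (quasi-)norms. ''Increasing'' and ''decreasing'' are in the weak sense. $f^*$ is the decreasing rearrangement of $f$. A function $\varphi:(0,\infty)\to(0,\infty)$ is quasi-concave if it is increasing and $\varphi(t)/t$ is decreasing; we put $\varphi(0)=0$. More generally, for an increasing $w:(0,\infty)\to(0,\infty)$, the Lorentz space $\Lambda_w$ consists of all $f$ with $\|f\|_{\Lambda_w}=\int_0^\infty f^*(t)\,dw(t)<\infty$, where the Stieltjes integral includes the mass $w(0+)$ at the origin; equivalently $\|f\|_{\Lambda_w}=\int_0^\infty w(|\{x:|f(x)|>s\}|)\,ds$ with $w(0)=0$. For an r.i. (quasi-Banach) space $X$, $W_X(t)=\big\|\frac{1}{1+\cdot/t}\big\|_X$ and $R(X)=\Lambda_{W_X}$. *)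

(* Defs.v *)
From HB Require Import structures.
From mathcomp Require Import all_boot all_order all_algebra.
From mathcomp Require Import all_classical all_reals all_analysis.
Set Implicit Arguments.
Unset Strict Implicit.
Unset Printing Implicit Defensive.
Import Order.TTheory GRing.Theory Num.Theory.
Import numFieldNormedType.Exports.
Local Open Scope classical_set_scope.
Local Open Scope ring_scope.

(* A function on (0, oo) is a total function R -> R whose values outside
   ]0, +oo[ are never used. *)

Definition distribution_fun (R : realType) (f : R -> R) (s : R) : \bar R :=
  lebesgue_measure ([set x | 0 < x /\ s < `|f x|] : set R).

(* For t = 0 this is the essential supremum of |f|. *)
Definition rearrangement (R : realType) (f : R -> R) (t : R) : \bar R :=
  ereal_inf [set s%:E | s in [set s : R |
    0 <= s /\ (distribution_fun f s <= t%:E)%E]].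

(* A function space is given by its extended-valued (quasi-)norm. *)
Definition quasinorm (R : realType) := (R -> R) -> \bar R.

Definition in_space (R : realType) (X : quasinorm R) (f : R -> R) : Prop :=
  measurable_fun (`]0, +oo[ : set R) f /\ (X f < +oo)%E.

Definition same_space (R : realType) (X Y : quasinorm R) : Prop :=
  (forall f : R -> R, in_space X f <-> in_space Y f) /\
  exists c C : R, [/\ 0 < c, 0 < C &
    forall f : R -> R, in_space X f ->
      (c%:E * Y f <= X f)%E /\ (X f <= C%:E * Y f)%E].

Definition quasi_concave (R : realType) (phi : R -> R) : Prop :=
  [/\ forall t : R, 0 < t -> 0 < phi t,
      forall s t : R, 0 < s -> s <= t -> phi s <= phi t &
      forall s t : R, 0 < s -> s <= t -> phi t / t <= phi s / s].

(* The right-continuous distribution function of the Stieltjes measure dw.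
   If w is positive and increasing on ]0, +oo[, then
   cumul w t = 0 for t < 0 and cumul w t = w(t+) for t >= 0, so that the
   jump at 0 is w(0+).  The maximum with 0 only makes cumul w nondecreasing
   and right-continuous for an arbitrary w. *)
Definition cumul (R : realType) (w : R -> R) (t : R) : R :=
  inf [set (if 0 < s then Num.max 0 (w s) else 0) | s in [set s | t < s]].

Lemma cumul_has_inf (R : realType) (w : R -> R) (t : R) :
  has_inf [set (if 0 < s then Num.max 0 (w s) else 0) | s in [set s | t < s]].
Proof.
split; first by eexists; exists (t + 1) => //=; rewrite ltrDl.
by exists 0 => _ [s _ <-]; case: ifP => // _; rewrite le_max lexx.
Qed.

Lemma cumul_nondecreasing (R : realType) (w : R -> R) :
  nondecreasing (cumul w).
Proof.
move=> x y xy; apply: lb_le_inf; first by case: (cumul_has_inf w y).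
move=> _ [s /= ys <-]; apply: ge_inf; first by case: (cumul_has_inf w x).
by exists s => //=; exact: le_lt_trans ys.
Qed.

Lemma cumul_right_continuous (R : realType) (w : R -> R) :
  right_continuous (cumul w).
Proof.
move=> x; apply/cvgrPdist_lt => e e0.
have [_ [s /= xs <-] hs] := inf_adherent e0 (cumul_has_inf w x).
near=> y.
have xy : x < y by near: y; exact: nbhs_right_gt.
have cxy : cumul w x <= cumul w y by apply: cumul_nondecreasing; exact: ltW.
rewrite distrC ger0_norm ?subr_ge0//.
rewrite ltrBlDl; apply: le_lt_trans hs.
apply: ge_inf; first by case: (cumul_has_inf w y).
by exists s => //=; near: y; exact: nbhs_right_lt.
Unshelve. all: by end_near. Qed.

HB.instance Definition _ (R : realType) (w : R -> R) :=
  isCumulative.Build R _ R (cumul w)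
    (@cumul_nondecreasing R w) (@cumul_right_continuous R w).

Definition lorentz (R : realType) (w : R -> R) : quasinorm R := fun f =>
  (\int[lebesgue_stieltjes_measure (cumul w)]_(t in `[0%R, +oo[)
     rearrangement f t)%E.

Definition weak_lorentz (R : realType) (phi : R -> R) : quasinorm R := fun f =>
  ereal_sup [set (rearrangement f t * (phi t)%:E)%E | t in [set t | 0 < t]].

Definition W_fun (R : realType) (X : quasinorm R) (t : R) : \bar R :=
  X (fun x => 1 / (1 + x / t)).

(* Meaningful when W_fun X is finite on ]0, +oo[, i.e. when X contains the
   functions x |-> 1 / (1 + x / t). *)
Definition R_space (R : realType) (X : quasinorm R) : quasinorm R :=
  lorentz (fun t => fine (W_fun X t)).

(* Main.v *)
Require Import Defs.
From mathcomp Require Import all_boot all_order all_algebra.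
From mathcomp Require Import all_classical all_reals all_analysis.
From mathcomp Require Import measurable_realfun ring lra.
Set Implicit Arguments.
Unset Strict Implicit.
Unset Printing Implicit Defensive.
Import Order.TTheory GRing.Theory Num.Theory.
Import numFieldNormedType.Exports.
Local Open Scope classical_set_scope.
Local Open Scope ring_scope.

(** Since 1 / (1 + x / t) is its own rearrangement, the weight W of the space
    [R_space (weak_lorentz phi)] is W(t) = sup_s t phi(s) / (t + s).  The term
    s = t gives W(t) >= phi(t) / 2, and quasi-concavity gives W(t) <= phi(t):
    use phi(s) <= phi(t) when s <= t and phi(s) / s <= phi(t) / t when s > t.
    By the layer cake formula the integral of the decreasing function f^* only
    depends on the Stieltjes measures of the initial segments {f^* > s}, so
    pointwise comparable weights give comparable Lorentz norms. *)

(** * The layer cake formula *)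

Section layer_cake.
Local Open Scope ereal_scope.
Context d (T : measurableType d) (R : realType).

(** This evaluates the inner integral of the layer cake formula, including the value [+oo]. *)
Lemma lebesgue_measure_below (y : \bar R) : 0 <= y ->
  lebesgue_measure [set s : R | (0 <= s)%R /\ s%:E < y] = y.
Proof.
case: y => [y| |]// y0.
- rewrite (_ : [set _ | _] = `[0%R, y[%classic); last first.
    by apply/seteqP; split => s /=; rewrite in_itv/= lte_fin => /andP.
  rewrite lebesgue_measure_itv/= lte_fin EFinN sube0.
  move: y0; rewrite lee_fin le_eqVlt => /predU1P[<-|->]//; by rewrite ltxx.
- rewrite (_ : [set _ | _] = `[0%R, +oo[%classic); last first.
    apply/seteqP; split => s /=; rewrite in_itv/= ?andbT; first by case.
    by split=> //; rewrite ltry.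
  by rewrite lebesgue_measure_itv/= ltry.
Qed.

(** Tonelli's theorem applied to the indicator of the region between 0 and the graph of [f]:
    vertical slices have length [f x], horizontal ones are the superlevel sets. *)
Lemma ge0_integral_superlevel (m : {sigma_finite_measure set T -> \bar R})
    (D : set T) (f : T -> \bar R) :
  measurable D -> measurable_fun D f -> (forall x, D x -> 0 <= f x) ->
  \int[m]_(x in D) f x =
  \int[lebesgue_measure]_(s in `[0%R, +oo[) m (D `&` [set x | s%:E < f x]).
Proof.
move=> mD mf f0.
pose g := f \_ D.
have g0 x : 0 <= g x by rewrite /g; exact: erestrict_ge0.
have mg : measurable_fun setT g by exact/(measurable_restrictT _ mD).
pose RT := measurableTypeR R.
pose A : set (T * RT) := [set p | (0 <= p.2)%R /\ p.2%:E < g p.1].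
have mA : measurable A.
  have m1 : measurable_fun [set: T * RT] (fun p => p.2%:E : \bar R).
    by apply/measurable_EFinP; exact: measurable_snd.
  have m2 : measurable_fun [set: T * RT] (g \o fst).
    exact: measurableT_comp.
  have m3 := measurable_lte measurableT m1 m2.
  have m4 : measurable ([set: T * RT] `&` [set p | 0 <= p.2%:E]).
    exact: emeasurable_fun_c_infty.
  suff -> : A = ([set: T * RT] `&` [set p | 0 <= p.2%:E]) `&`
      ([set: T * RT] `&` [set p | p.2%:E < g p.1]) by exact: measurableI.
  by rewrite !setTI; apply/seteqP; split => p /=; rewrite lee_fin.
have -> : \int[m]_(x in D) f x = \int[m]_x g x by rewrite integral_mkcond.
transitivity (\int[m]_x \int[@lebesgue_measure R]_s (\1_A (x, s))%:E).
  apply: eq_integral => x _.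
  rewrite (_ : (fun s : R => (\1_A (x, s))%:E) =
     fun s => (\1_[set s : R | (0 <= s)%R /\ (s%:E < g x)%E] s)%:E); last first.
    by apply/funext => s; rewrite !indicE.
  rewrite integral_indic//.
    by rewrite setIT; exact/esym/lebesgue_measure_below.
  suff -> : [set s : R | (0 <= s)%R /\ s%:E < g x] = xsection A x.
    exact: measurable_xsection.
  by apply/seteqP; split => s; rewrite /xsection/= inE.
rewrite (fubini_tonelli (fun p : T * RT => (\1_A p)%:E))//; last first.
  exact/measurable_EFinP/measurable_indic.
rewrite [RHS]integral_mkcond; apply: eq_integral => s _.
rewrite patchE; case: ifPn => s0.
  have {}s0 : (0 <= s)%R by move: s0; rewrite inE/= in_itv/= andbT.
  rewrite (_ : (fun x => (\1_A (x, s))%:E) =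
     fun x => (\1_(D `&` [set x | (s%:E < f x)%E]) x)%:E); last first.
    apply/funext => x; rewrite !indicE; congr ((nat_of_bool _)%:R%:E).
    apply/idP/idP; rewrite !inE/= /A/= /g patchE.
      (* Off [D] the extension [g] is 0, which never exceeds a level [s >= 0]. *)
      by case: ifPn => [/set_mem Dx []//|_ [_]]; rewrite lte_fin ltNge s0.
    by move=> [Dx sf]; rewrite mem_set.
  by rewrite integral_indic ?setIT//; exact: emeasurable_fun_o_infty.
(* Negative levels contribute nothing, since [A] only contains points with [0 <= p.2]. *)
apply: integral0_eq => x _; rewrite indicE memNset// => -[/= s1 _].
by move: s0; rewrite notin_setE/= in_itv/= s1.
Qed.

End layer_cake.

(** Continuity from below; it extends bounds on closed segments to half-open and unbounded ones. *)
Lemma measure_bigcup_le d (T : measurableType d) (R : realType)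
    (m : {measure set T -> \bar R}) (A : (set T)^nat) (c : \bar R) :
  (forall n, measurable (A n)) -> nondecreasing_seq A ->
  (forall n, m (A n) <= c)%E -> (m (\bigcup_n A n) <= c)%E.
Proof.
move=> mA ndA mAc.
have mU : measurable (\bigcup_n A n) by exact: bigcup_measurable.
have cvgA := @nondecreasing_cvg_mu _ _ _ m _ mA mU ndA.
rewrite -(cvg_lim _ cvgA)//; apply: lime_le; last exact: nearW.
by apply/cvg_ex; eexists; exact: cvgA.
Qed.

(** * Stieltjes measures of initial segments of the half-line *)

Section stieltjes.
Local Open Scope ereal_scope.
Context {R : realType}.
Implicit Types F G : cumulative R R.
Notation mu := lebesgue_stieltjes_measure.

Lemma lebesgue_stieltjes_itvoc F (a b : R) : (a <= b)%R ->
  mu F `]a, b] = (F b - F a)%:E.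
Proof.
move=> ab; rewrite /lebesgue_stieltjes_measure /measure_extension.
by rewrite measurable_mu_extE/= ?wlength_itv_bnd//; exact: is_ocitv.
Qed.

(** Write []-1, b]] as []-1, 0[] and [[0, b]]: the first piece is null because [F] vanishes on the
    negatives, so the atom at 0 is counted in [F b]. *)
Lemma lebesgue_stieltjes_itvcc0 F (b : R) : (0 <= b)%R ->
  (forall t, (t < 0)%R -> F t = 0%R) -> mu F `[0%R, b] = (F b)%:E.
Proof.
move=> b0 F0.
have F1 : F (-1)%R = 0%R by apply: F0; rewrite oppr_lt0.
have m0 : mu F `](-1)%R, 0%R[ = 0.
  (* []-1, 0[] is the increasing union of the null intervals []-1, - 1 / (n + 1)]]. *)
  apply/eqP; rewrite eq_le measure_ge0 andbT itv_bnd_open_bigcup.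
  apply: measure_bigcup_le => //.
    move=> m n mn; apply/subsetPset/subset_itvl; rewrite bnd_simp lerB//.
    by rewrite lef_pV2 ?posrE ?ltr0n// ler_nat ltnS.
  move=> n /=.
  have n1 : (-1 <= 0 - n.+1%:R^-1 :> R)%R.
    by rewrite sub0r lerN2 invf_le1 ?ler1n ?ltr0n.
  have n0 : (0 - n.+1%:R^-1 < 0 :> R)%R.
    by rewrite sub0r oppr_lt0 invr_gt0 ltr0n.
  by rewrite (lebesgue_stieltjes_itvoc F n1) F1 (F0 _ n0) subrr.
have := lebesgue_stieltjes_itvoc F (le_trans (lerN10 R) b0).
rewrite F1 subr0 => <-.
have -> : `](-1)%R, b]%classic = `](-1)%R, 0%R[ `|` `[0%R, b].
  by rewrite -itv_bndbnd_setU// bnd_simp// oppr_lt0.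
rewrite measureU//=; first by rewrite m0 add0e.
apply/seteqP; split => // x [] /=; rewrite !in_itv/= => /andP[_ x0] /andP[].
by rewrite leNgt x0.
Qed.

(** A down-closed [I] is empty, [[0, b]], [[0, b[] or [[0, +oo[]. A closed segment is handled by the
    bound on [F]; the last two are increasing unions of closed segments. *)
Lemma lebesgue_stieltjes_initial_segment_le F G (C : R) (I : set R) :
  (0 <= C)%R -> (forall t, (t < 0)%R -> F t = 0%R) ->
  (forall t, (t < 0)%R -> G t = 0%R) ->
  (forall t, (0 <= t)%R -> F t <= C * G t)%R ->
  (forall t, I t -> 0 <= t)%R ->
  (forall s t, I t -> 0 <= s -> s <= t -> I s)%R ->
  mu F I <= C%:E * mu G I.
Proof.
move=> C0 F0 G0 FG I0 Idown.
have mI : measurable (I : set (measurableTypeR R)).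
  apply: is_interval_measurable => s t Is It u /andP[su ut].
  by apply: (Idown _ t) => //; exact: le_trans (I0 _ Is) su.
(* The right-hand side already has all of [I], so only the measure of [F] has to pass to the
   limit. *)
have le_segment b : `[0%R, b] `<=` I -> mu F `[0%R, b] <= C%:E * mu G I.
  move=> bI; have [b0|b0] := leP 0%R b; last first.
    by rewrite set_itv_ge ?measure0 ?mule_ge0//= bnd_simp -ltNge.
  rewrite lebesgue_stieltjes_itvcc0//.
  apply: (@le_trans _ _ (C%:E * mu G `[0%R, b])).
    by rewrite lebesgue_stieltjes_itvcc0// lee_fin FG.
  by rewrite lee_wpmul2l ?lee_fin// le_measure ?inE//=; exact: measurable_itv.
have [[t It]|In] := pselect (exists t, I t); last first.
  rewrite (_ : I = set0) ?measure0 ?mule0//.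
  by apply/seteqP; split => // t It; apply: In; exists t.
have [ubI|nubI] := pselect (has_ubound I); last first.
  have IE : I = `[0%R, +oo[%classic.
    apply/seteqP; split => [s /I0|s]/=; rewrite in_itv/= andbT// => s0.
    apply: contrapT => Is; apply: nubI; exists s => u Iu.
    by rewrite leNgt; apply/negP => su; apply: Is; exact: Idown Iu s0 (ltW su).
  rewrite {1}IE itv_bndy_bigcup_BRight; apply: measure_bigcup_le => //.
    move=> m n mn; apply/subsetPset/subset_itvl.
    by rewrite bnd_simp lerD2l ler_nat.
  move=> n /=; rewrite add0r; apply: le_segment; rewrite IE => x /=.
  by rewrite !in_itv/= => /andP[->].
have hI : has_sup I by split=> //; exists t.
(* Whether the supremum is attained decides between [[0, sup I]] and [[0, sup I[]. *)
have [IsI|nIs] := pselect (I (sup I)).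
  have IE : I = `[0%R, sup I]%classic.
    apply/seteqP; split => s /=; rewrite in_itv/=.
      by move=> Is; rewrite I0//= ub_le_sup.
    by move=> /andP[s0 sI]; exact: Idown IsI s0 sI.
  by rewrite {1}IE; apply: le_segment; rewrite -IE.
have IE : I = `[0%R, sup I[%classic.
  apply/seteqP; split => s /=; rewrite in_itv/=.
    move=> Is; rewrite I0//= lt_neqAle ub_le_sup// andbT.
    by apply/eqP => sE; apply: nIs; rewrite -sE.
  move=> /andP[s0 /(sup_gt (ex_intro _ t It))[u Iu su]].
  exact: Idown Iu s0 (ltW su).
rewrite {1}IE itv_bnd_open_bigcup; apply: measure_bigcup_le => //.
  move=> m n mn; apply/subsetPset/subset_itvl; rewrite bnd_simp lerB//.
  by rewrite lef_pV2 ?posrE ?ltr0n// ler_nat ltnS.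
move=> n /=; apply: le_segment; rewrite [X in _ `<=` X]IE.
by apply: subset_itvl; rewrite bnd_simp ltrBlDr ltrDl invr_gt0 ltr0n.
Qed.

End stieltjes.

(** Superlevel sets of a nonincreasing function are down-closed, hence intervals. *)
Lemma nonincreasing_emeasurable (R : realType) (D : set R) (f : R -> \bar R) :
  measurable D -> (forall s t, s <= t -> (f t <= f s)%E) -> measurable_fun D f.
Proof.
move=> mD f_ni; apply: (measurability _ (ErealGenOInfty.measurableE R)) => //.
move=> _ [_ [x ->] <-]; apply: measurableI => //.
apply: is_interval_measurable => s t /=; rewrite !in_itv/= !andbT.
move=> _ xt u /andP[_ ut]; rewrite in_itv/= andbT.
by apply: lt_le_trans xt _; exact: f_ni.
Qed.

(** * Comparison of Lorentz norms with comparable weights *)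

Section lorentz_comparison.
Context {R : realType}.
Implicit Types (w : R -> R) (f : R -> R).

Lemma cumul_lt0 w (t : R) : t < 0 -> cumul w t = 0.
Proof.
move=> t0; apply/eqP; rewrite eq_le; apply/andP; split; last first.
  apply: lb_le_inf; first by case: (cumul_has_inf w t).
  by move=> _ [s _ <-]; case: ifP => // _; rewrite le_max lexx.
apply: ge_inf; first by case: (cumul_has_inf w t).
(* The point [t / 2] lies in []t, 0[], where the function under the infimum is 0. *)
by exists (t / 2) => /=; [lra|rewrite ltNge (_ : t / 2 <= 0)//; lra].
Qed.

(** The infimum defining [cumul] is monotone in the weight and commutes with multiplication by
    [C > 0]. *)
Lemma cumul_le w1 w2 (C : R) : 0 < C ->
  (forall t, 0 < t -> w1 t <= C * w2 t) ->
  forall t, cumul w1 t <= C * cumul w2 t.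
Proof.
move=> C0 w12 t; rewrite -ler_pdivrMl//.
apply: lb_le_inf; first by case: (cumul_has_inf w2 t).
move=> _ [s /= ts <-]; rewrite ler_pdivrMl//.
apply: (@le_trans _ _ (if 0 < s then Num.max 0 (w1 s) else 0)).
  by apply: ge_inf; [case: (cumul_has_inf w1 t)|exists s].
case: ifP => [s0|_]; last by rewrite mulr0.
by rewrite maxr_pMr ?(ltW C0)// mulr0 ge_max le_max lexx/= le_max w12// orbT.
Qed.

Lemma rearrangement_ge0 f (t : R) : (0 <= rearrangement f t)%E.
Proof. by apply/ereal_infP => _ [s [s0 _] <-]; rewrite lee_fin. Qed.

Lemma rearrangement_nonincreasing f (s t : R) : s <= t ->
  (rearrangement f t <= rearrangement f s)%E.
Proof.
move=> st; apply: ereal_inf_le_tmp => _ [u [u0 us] <-]; exists u => //.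
by split=> //; rewrite (le_trans us)// lee_fin.
Qed.

Lemma measurable_rearrangement f (D : set R) : measurable D ->
  measurable_fun D (rearrangement f).
Proof.
move=> mD; apply: nonincreasing_emeasurable => // s t.
exact: rearrangement_nonincreasing.
Qed.

Lemma lorentz_le w1 w2 (C : R) f : 0 < C ->
  (forall t, 0 < t -> w1 t <= C * w2 t) ->
  (lorentz w1 f <= C%:E * lorentz w2 f)%E.
Proof.
(* The measure of the superlevel set of the rearrangement at height [s]; it decreases in [s], hence
   is measurable. *)
pose super w (s : R) := lebesgue_stieltjes_measure (cumul w)
  ((`[0, +oo[ : set R) `&` [set t | (s%:E < rearrangement f t)%E]).
have msuper w : measurable_fun (`[0, +oo[ : set R) (super w).
  apply: nonincreasing_emeasurable => // s t st.
  apply: le_measure; rewrite ?inE.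
  - by apply: emeasurable_fun_o_infty => //; exact: measurable_rearrangement.
  - by apply: emeasurable_fun_o_infty => //; exact: measurable_rearrangement.
  - by apply: setIS => u /=; apply: le_lt_trans; rewrite lee_fin.
have lorentzE w :
    lorentz w f = (\int[lebesgue_measure]_(s in `[0%R, +oo[) super w s)%E.
  apply: ge0_integral_superlevel => //; first exact: measurable_rearrangement.
  by move=> t _; exact: rearrangement_ge0.
move=> C0 w12; rewrite !lorentzE.
rewrite -ge0_integralZl//; [|exact: msuper|by rewrite lee_fin ltW].
apply: ge0_le_integral => //.
- exact: msuper.
- by apply: measurable_funeM; exact: msuper.
move=> s; rewrite /= in_itv/= andbT => s0.
(* The superlevel sets are initial segments because the rearrangement is nonincreasing. *)
apply: lebesgue_stieltjes_initial_segment_le.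
- exact: ltW.
- exact: cumul_lt0.
- exact: cumul_lt0.
- by move=> t _; exact: cumul_le.
- by move=> t [/=]; rewrite in_itv/= andbT.
- move=> t u [_ /= su] t0 tu; split; first by rewrite /= in_itv/= t0.
  by apply: lt_le_trans su _; exact: rearrangement_nonincreasing.
Qed.

End lorentz_comparison.

(** * The weight of the weak Lorentz space *)

Section weak_lorentz_weight.
Context {R : realType}.

Lemma rearrangement_hyperbola (t r : R) : 0 < t -> 0 < r ->
  rearrangement (fun x => 1 / (1 + x / t)) r = (t / (t + r))%:E.
Proof.
move=> t0 r0; have tr0 : 0 < t + r by rewrite addr_gt0.
have E x : 0 < x -> 1 / (1 + x / t) = t / (t + x).
  by move=> x0; field; rewrite !gt_eqF// addr_gt0.
have N x : 0 < x -> `|1 / (1 + x / t)| = t / (t + x).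
  by move=> x0; rewrite E// ger0_norm// divr_ge0// ltW// addr_gt0.
apply/eqP; rewrite eq_le; apply/andP; split.
  (* At the level [t / (t + r)] the superlevel set is exactly []0, r[]. *)
  apply: ereal_inf_lbound; exists (t / (t + r)) => //; split.
    by rewrite divr_ge0// ltW.
  rewrite /distribution_fun (_ : [set _ | _] = `]0, r[%classic).
    by rewrite lebesgue_measure_itv/= lte_fin r0 EFinN sube0.
  apply/seteqP; split => x /=; rewrite in_itv/=.
    move=> [x0]; rewrite N// x0 ltr_pM2l// ltf_pV2 ?posrE ?addr_gt0//.
    by rewrite ltrD2l.
  move=> /andP[x0 xr]; split=> //; rewrite N// ltr_pM2l//.
  by rewrite ltf_pV2 ?posrE ?addr_gt0// ltrD2l.
apply/ereal_infP => _ [s [s0 dfs] <-]; rewrite lee_fin leNgt; apply/negP => str.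
(* A level strictly between [s] and [t / (t + r)], positive even if [s = 0]. The hyperbola takes the
   value [u] at [t / u - t > r], so it exceeds [s] on an interval longer than [r]. *)
pose u := (s + t / (t + r)) / 2.
have su : s < u by rewrite /u; lra.
have u0 : 0 < u by exact: le_lt_trans su.
have utr : u < t / (t + r) by rewrite /u; lra.
have rtu : r < t / u - t.
  by rewrite ltrBrDl ltr_pdivlMr// mulrC -ltr_pdivlMr.
have tu0 : 0 < t / u - t by exact: lt_trans rtu.
have : (lebesgue_measure (`]0%R, (t / u - t)%R[ : set R) <= r%:E)%E.
  apply: le_trans dfs; apply: le_measure; rewrite ?inE//=.
    apply: is_interval_measurable => x y /= [x0 _] [y0 sy] z /andP[xz zy].
    have z0 : 0 < z := lt_le_trans x0 xz.
    split=> //; apply: (lt_le_trans sy); rewrite !N//.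
    by rewrite ler_pM2l// lef_pV2 ?posrE ?addr_gt0// lerD2l.
  move=> x /=; rewrite in_itv/= => /andP[x0 xtu]; split=> //; rewrite N//.
  apply: (lt_trans su); rewrite ltr_pdivlMr ?addr_gt0// mulrC -ltr_pdivlMr//.
  by rewrite -ltrBrDl.
by rewrite lebesgue_measure_itv/= lte_fin tu0 EFinN sube0 lee_fin leNgt rtu.
Qed.

Lemma W_weak_lorentz (phi : R -> R) (t : R) : quasi_concave phi -> 0 < t ->
  ((phi t / 2)%:E <= W_fun (weak_lorentz phi) t <= (phi t)%:E)%E.
Proof.
move=> [phi0 phi_nd phi_ni] t0; apply/andP; split.
  apply: ereal_sup_ubound; exists t => //=.
  rewrite rearrangement_hyperbola// -EFinM; congr _%:E.
  by field; rewrite gt_eqF ?addr_gt0.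
apply/ereal_supP => _ [s /= s0 <-].
rewrite rearrangement_hyperbola// -EFinM lee_fin.
rewrite mulrAC ler_pdivrMr ?addr_gt0//.
(* The goal is [t * phi s <= phi t * (t + s)]; one summand on the right suffices, [phi t * t] if
   [s <= t] and [phi t * s] otherwise. *)
have [st|ts] := leP s t.
  rewrite mulrC mulrDr -[leLHS]addr0 lerD//.
    by rewrite ler_pM2r// phi_nd.
  by rewrite mulr_ge0// ltW// phi0.
have := phi_ni _ _ t0 (ltW ts).
rewrite ler_pdivrMr// mulrAC ler_pdivlMr// => h.
by rewrite mulrC mulrDr -[leLHS]add0r lerD// mulr_ge0// ltW// phi0.
Qed.

End weak_lorentz_weight.

(** * Equivalence of the two norms *)

Theorem theorem3p1 (R : realType) (phi : R -> R) :
  quasi_concave phi -> same_space (R_space (weak_lorentz phi)) (lorentz phi).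
Proof.
move=> qphi.
pose W t := fine (W_fun (weak_lorentz phi) t).
have W_bounds t : 0 < t -> phi t / 2 <= W t <= phi t.
  move=> t0; have := W_weak_lorentz qphi t0; rewrite /W.
  (* The two bounds exclude infinite values, so [fine] loses nothing. *)
  by case: (W_fun _ _) => [r| |] //=; rewrite ?lee_fin// ?leye_eq// ?andbF.
have W_le f : (R_space (weak_lorentz phi) f <= 1%:E * lorentz phi f)%E.
  by apply: lorentz_le => // t /W_bounds /andP[_]; rewrite mul1r.
have le_W f : (lorentz phi f <= 2%:E * R_space (weak_lorentz phi) f)%E.
  by apply: lorentz_le => // t /W_bounds /andP[]; rewrite ler_pdivrMr// mulrC.
split.
  move=> f; split=> -[mf fin]; (split; first exact: mf).
    by apply: le_lt_trans (le_W f) _; rewrite lte_mul_pinfty.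
  by apply: le_lt_trans (W_le f) _; rewrite mul1e.
(* The constants are those of [le_W], inverted, and of [W_le]. *)
exists 2^-1, 1; split=> // f _; split; last exact: W_le.
by rewrite lee_pdivrMl.
Qed.
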